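(* Let $G$ be a connected non-compact real semisimple Lie group, $\sigma$ an involutive automorphism of $G$, and $H$ a closed subgroup of $G$ with $(G^\sigma)_0\subset H\subset G^\sigma$. Let $\theta$ be a Cartan involution of $G$ commuting with $\sigma$, $K=G^\theta$, and $K_H=K\cap H$. Let $\mathfrak a_0$ and $\mathfrak b_0$ be two maximal abelian subspaces of $\mathfrak p_0\cap\mathfrak q_0$, put $A=\exp\mathfrak a_0$ and $B=\exp\mathfrak b_0$, and let $\ell\in K_H$ be such that $\mathfrak b_0=\operatorname{Ad}(\ell)\mathfrak a_0$, so that $B=\ell A\ell^{-1}$. Then $$N_{K\times H}(B)=\ell*N_{K\times H}(A)\quad\text{and}\quad Z_{K\times H}(B)=\ell*Z_{K\times H}(A).$$
   Context: For an automorphism $\nu$ of $G$, $G^\nu=\{g\in G:\nu(g)=g\}$, and $(G^\nu)_0$ is its identity component. The differentials of $\sigma,\theta$ on the Lie algebra $\mathfrak g_0$ of $G$ are denoted by the same letters. $\mathfrak p_0=\{X\in\mathfrak g_0:\theta(X)=-X\}$ and $\mathfrak q_0=\{X\in\mathfrak g_0:\sigma(X)=-X\}$. The group $K=G^\theta$ is connected and is a maximal compact subgroup of $G$. Any two maximal abelian subspaces of $\mathfrak p_0\cap\mathfrak q_0$ are conjugate under $\operatorname{Ad}(K_H)$, so an $\ell$ as in the statement exists. $G\times G$ acts on $G$ by $(g_1,g_2)\cdot x=g_1xg_2^{-1}$. $G$ acts on $G\times G$ by $g*(x_1,x_2)=(gx_1g^{-1},gx_2g^{-1})$, and $g*S=\{g*s:s\in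 S\}$ for $S\subset G\times G$. For a subset $C\subset G$: $N_{K\times H}(C)=\{(k,h)\in K\times H:(k,h)\cdot C=C\}$, $Z_{K\times H}(C)=\{(k,h)\in K\times H:(k,h)\cdot c=c\ \text{for all } c\in C\}$. *)

(* Defs.v *)
From HB Require Import structures.
From mathcomp Require Import all_boot all_order all_algebra.
From mathcomp Require Import all_classical all_reals all_analysis.
Set Implicit Arguments.
Unset Strict Implicit.
Unset Printing Implicit Defensive.
Import Order.TTheory GRing.Theory Num.Theory.
Import numFieldNormedType.Exports.
Local Open Scope classical_set_scope.
Local Open Scope ring_scope.

(* [is_Ck k U f] is used only for open [U] and finite-dimensional [V], where it
   means that [f] is of class C^k on [U]. *)
Fixpoint is_Ck (R : realType) (V W : normedModType R) (k : nat) (U : set V)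
    (f : V -> W) : Prop :=
  match k with
  | 0%N => forall x, U x -> {for x, continuous f}
  | k'.+1 => (forall x, U x -> differentiable f x) /\
             (forall v : V, is_Ck k' U ('D_v f))
  end.

Definition smooth_on (R : realType) (V W : normedModType R) (U : set V)
    (f : V -> W) : Prop := forall k, is_Ck k U f.

(* A chart [c] is the map [cmap c : cdom c -> E] with inverse [cinv c], both
   extended to total functions with irrelevant values outside [cdom c] and
   [cmap c @` cdom c]. *)
Record chart (M : Type) (E : Type) := Chart {
  cdom : set M;
  cmap : M -> E;
  cinv : E -> M
}.

Definition is_chart (R : realType) (E : normedModType R) (M : topologicalType)
    (c : chart M E) : Prop :=
  [/\ open (cdom c),
      open (cmap c @` cdom c),
      (forall x, cdom c x -> cinv c (cmap c x) = x),
      (forall x, cdom c x -> {for x, continuous (cmap c)}) &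
      (forall y, (cmap c @` cdom c) y -> {for y, continuous (cinv c)})].

Definition is_smooth_atlas (R : realType) (E : normedModType R)
    (M : topologicalType) (A : set (chart M E)) : Prop :=
  [/\ (forall c, A c -> is_chart c),
      (forall x, exists2 c, A c & cdom c x) &
      (forall c d, A c -> A d ->
         smooth_on (cmap c @` (cdom c `&` cdom d)) (cmap d \o cinv c))].

Definition smooth_map (R : realType) (E F : normedModType R)
    (M N : topologicalType) (A : set (chart M E)) (B : set (chart N F))
    (f : M -> N) : Prop :=
  continuous f /\
  forall c d, A c -> B d ->
    smooth_on (cmap c @` (cdom c `&` f @^-1` cdom d))
              (cmap d \o f \o cinv c).

Definition real_atlas (R : realType) : set (chart R R^o) :=
  [set Chart setT id id].

Definition prod_chart (M N E F : Type) (c : chart M E) (d : chart N F) :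
    chart (M * N)%type (E * F)%type :=
  Chart (cdom c `*` cdom d)
        (fun x => (cmap c x.1, cmap d x.2))
        (fun y => (cinv c y.1, cinv d y.2)).

Definition prod_atlas (M N E F : Type) (A : set (chart M E))
    (B : set (chart N F)) : set (chart (M * N)%type (E * F)%type) :=
  [set prod_chart c d | c in A & d in B].

HB.mixin Record isLieGroup (R : realType) (n : nat) G
    of Topological G & Group G := {
  lie_atlas : set (chart G 'rV[R]_n);
  lie_hausdorff : hausdorff_space G;
  lie_second_countable : @second_countable G;
  lie_atlasP : is_smooth_atlas lie_atlas;
  lie_mul_smooth : smooth_map (prod_atlas lie_atlas lie_atlas) lie_atlas
                     (fun xy : G * G => (xy.1 * xy.2)%g);
  lie_inv_smooth : smooth_map lie_atlas lie_atlas (fun x : G => (x^-1)%g)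
}.

#[short(type="lieGroupType")]
HB.structure Definition LieGroup (R : realType) (n : nat) :=
  {G of Topological G & Group G & isLieGroup R n G}.

Section LieGroupTheory.
Context {R : realType} {n : nat} {G : lieGroupType R n}.

Definition subgroup (H : set G) : Prop :=
  [/\ H 1%g, (forall x y, H x -> H y -> H (x * y)%g) &
      (forall x, H x -> H (x^-1)%g)].

Definition lie_smooth (f : G -> G) : Prop :=
  smooth_map (@lie_atlas R n G) (@lie_atlas R n G) f.

Definition lie_automorphism (nu : G -> G) : Prop :=
  [/\ {morph nu : x y / (x * y)%g}, lie_smooth nu &
      exists nu' : G -> G, [/\ cancel nu nu', cancel nu' nu & lie_smooth nu']].

Definition involutive_automorphism (nu : G -> G) : Prop :=
  lie_automorphism nu /\ involutive nu.

Definition fixed_points (nu : G -> G) : set G := [set g | nu g = g].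

Definition identity_component (H : set G) : set G :=
  connected_component H 1%g.

Definition smooth_fun (f : G -> R^o) : Prop :=
  smooth_map (@lie_atlas R n G) (@real_atlas R) f.

(* [lie_algebra] consists of the left-invariant vector fields on [G], a vector
   field being a derivation of the algebra of smooth functions.  It is a
   subspace of the ambient [lmodType] of all maps [(G -> R^o) -> (G -> R^o)];
   the value 0 at functions that are not smooth makes equality of such maps
   coincide with equality of vector fields. *)
Definition lie_algebra : set ((G -> R^o) -> (G -> R^o)) :=
  [set X |
   [/\ (forall f, smooth_fun f -> smooth_fun (X f)),
       (forall a f g, smooth_fun f -> smooth_fun g ->
          X (a *: f + g) = a *: X f + X g),
       (forall f g, smooth_fun f -> smooth_fun g ->
          X (f * g) = X f * g + f * X g),
       (forall (x : G) f, smooth_fun f ->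
          X (fun y => f (x * y)%g) = fun y => X f (x * y)%g) &
       (forall f, ~ smooth_fun f -> X f = 0)]].

Definition lie_bracket (X Y : (G -> R^o) -> (G -> R^o)) :
    (G -> R^o) -> (G -> R^o) := (X \o Y) - (Y \o X).

(* The tangent vector at 1 of the left-invariant field [X] is [f |-> X f 1];
   [differential nu X] is the left-invariant field whose tangent vector at 1 is
   the image of that of [X] under the derivative of [nu] at 1. *)
Definition differential (nu : G -> G) (X : (G -> R^o) -> (G -> R^o)) :
    (G -> R^o) -> (G -> R^o) :=
  fun f g => X (fun x => f (g * nu x)%g) 1%g.

Definition Ad (g : G) : ((G -> R^o) -> (G -> R^o)) -> (G -> R^o) -> (G -> R^o) :=
  differential (fun x => g * x * g^-1)%g.

Definition one_parameter_subgroup (gamma : R -> G) : Prop :=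
  {morph gamma : s t / s + t >-> (s * t)%g} /\
  smooth_map (@real_atlas R) (@lie_atlas R n G) gamma.

(* The graph of the exponential map, [g = exp X]: one has [exp X = gamma 1] for
   the one-parameter subgroup [gamma] with velocity [X] at 0. *)
Definition is_exp (X : (G -> R^o) -> (G -> R^o)) (g : G) : Prop :=
  exists gamma : R -> G,
    [/\ one_parameter_subgroup gamma,
        (forall f, smooth_fun f -> is_derive (0 : R) 1 (f \o gamma) (X f 1%g)) &
        gamma 1 = g].

Definition exp_image (V : set ((G -> R^o) -> (G -> R^o))) : set G :=
  [set g | exists2 X, V X & is_exp X g].

End LieGroupTheory.

Definition is_subspace (R : realType) (L : lmodType R) (V : set L) : Prop :=
  V 0 /\ forall (a : R) X Y, V X -> V Y -> V (a *: X + Y).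

Definition is_basis (R : realType) (L : lmodType R) (V : set L) (m : nat)
    (e : 'I_m -> L) : Prop :=
  (forall i, V (e i)) /\
  forall X, V X -> exists! c : 'rV[R]_m, X = \sum_i c 0 i *: e i.

(* The trace of [T] on the [T]-stable finite-dimensional subspace [V], computed
   in any basis of [V]; it is 0 when [V] has no finite basis. *)
Definition trace_on (R : realType) (L : lmodType R) (V : set L) (T : L -> L) : R :=
  xget 0 [set t | exists m (e : 'I_m -> L) (M : 'M[R]_m),
    [/\ is_basis V e, (forall i, T (e i) = \sum_j M i j *: e j) & t = \tr M]].

Section Semisimple.
Context {R : realType} {n : nat} {G : lieGroupType R n}.

Definition killing (X Y : (G -> R^o) -> (G -> R^o)) : R :=
  trace_on (@lie_algebra R n G) (fun Z => lie_bracket X (lie_bracket Y Z)).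

Definition semisimple : Prop :=
  forall X, @lie_algebra R n G X ->
    (forall Y, @lie_algebra R n G Y -> killing X Y = 0) -> X = 0.

Definition cartan_involution (theta : G -> G) : Prop :=
  involutive_automorphism theta /\
  forall X, @lie_algebra R n G X -> X != 0 ->
    0 < - killing X (differential theta X).

Definition minus_eigenspace (nu : G -> G) : set ((G -> R^o) -> (G -> R^o)) :=
  [set X | lie_algebra X /\ differential nu X = - X].

Definition abelian_subspace_of (W V : set ((G -> R^o) -> (G -> R^o))) : Prop :=
  [/\ is_subspace V, V `<=` W &
      forall X Y, V X -> V Y -> lie_bracket X Y = 0].

Definition maximal_abelian_subspace_of (W V : set ((G -> R^o) -> (G -> R^o))) :
    Prop :=
  abelian_subspace_of W V /\
  forall V', abelian_subspace_of W V' -> V `<=` V' -> V' = V.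

End Semisimple.

Section Actions.
Context {G : groupType}.

Definition two_sided_act (g : G * G) (x : G) : G := (g.1 * x * g.2^-1)%g.

Definition diag_conj (g : G) (x : G * G) : G * G :=
  (g * x.1 * g^-1, g * x.2 * g^-1)%g.

Definition normalizer_in (K H C : set G) : set (G * G) :=
  [set g | (K `*` H) g /\ two_sided_act g @` C = C].

Definition centralizer_in (K H C : set G) : set (G * G) :=
  [set g | (K `*` H) g /\ forall c, C c -> two_sided_act g c = c].

End Actions.

(* Main.v *)
(* Conjugation by [l] is smooth, so it carries the one-parameter subgroup with
   velocity [X] to the one with velocity [Ad l X]; hence [B = l A l^-1].  Since
   [l] lies in both [K] and [H], conjugating by [l] preserves [K] and [H] and
   intertwines the two-sided action of a pair with that of its conjugate.
   Smoothness in charts comes from the chain rule in coordinates,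
   [D_v (g \o f) = \sum_i (D_v f)_i *: (D_(e_i) g \o f)], by induction on the
   order of differentiability. *)
Require Import Defs.
From HB Require Import structures.
From mathcomp Require Import all_boot all_order all_algebra.
From mathcomp Require Import all_classical all_reals all_analysis.
Set Implicit Arguments.
Unset Strict Implicit.
Unset Printing Implicit Defensive.
Import Order.TTheory GRing.Theory Num.Theory.
Import numFieldNormedType.Exports.
Local Open Scope classical_set_scope.
Local Open Scope ring_scope.

(** * Maps of class C^k between normed spaces *)

Lemma near_eq_differentiable {R : numFieldType} {V W : normedModType R}
    (f g : V -> W) (x : V) :
  (\near x, f x = g x) -> differentiable f x -> differentiable g x.
Proof.
move=> fg /diff_locallyP[dfc dfx].
pose D : {linear V -> W} := 'd f x.
(* [g] inherits the first-order expansion of [f] at [x], with the same linear part [D]; uniqueness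
   of the linear part then gives ['d g x = D]. *)
have gx : g \o shift x = cst (g x) + D +o_ 0 id.
  have fg0 : \forall z \near 0, f (z + x) = g (z + x).
    by have := fg; rewrite (near_shift 0) subr0.
  apply/eqaddoP => e e0.
  move/eqaddoP : dfx => /(_ e e0).
  rewrite -(nbhs_singleton fg); apply: filterS2 fg0 => y fgy.
  by rewrite !fctE /= fgy.
by apply/diff_locallyP; rewrite (diff_unique dfc gx).
Qed.

Section Ck.
Context {R : realType}.
Implicit Types V W Z : normedModType R.

Lemma is_CkS V W k (U : set V) (f : V -> W) :
  is_Ck k.+1 U f =
  ((forall x, U x -> differentiable f x) /\ forall v, is_Ck k U ('D_v f)).
Proof. by []. Qed.

Lemma is_Ck_subset V W k (U U' : set V) (f : V -> W) :
  U' `<=` U -> is_Ck k U f -> is_Ck k U' f.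
Proof.
move=> sub; elim: k f => [|k IH] f /=; first by move=> fU x /sub/fU.
by move=> [df Df]; split => [x /sub/df//|v]; apply: IH.
Qed.

Lemma is_Ck_pred V W k (U : set V) (f : V -> W) : is_Ck k.+1 U f -> is_Ck k U f.
Proof.
elim: k f => [|k IH] f; first by case=> df _ x /df/differentiable_continuous.
by move=> [df Df]; split=> // v; apply: IH.
Qed.

(** Derivatives depend only on germs: if [g] models [f] on the open set [U'], then ['D_v g] models
    ['D_v f] on the same [U'], so the induction passes to derivatives. *)
Lemma is_Ck_local V W k (U : set V) (f : V -> W) :
  (forall x, U x -> exists g U',
     [/\ open U', U' x, is_Ck k U' g & forall y, U' y -> g y = f y]) ->
  is_Ck k U f.
Proof.
elim: k f => [|k IH] f fU.
  move=> x /fU[g [U' [oU' U'x gU' gf]]].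
  have gfx : {near x, g =1 f}.
    by have := open_nbhs_nbhs (conj oU' U'x); apply: filterS.
  rewrite /prop_for /continuous_at -(gf _ U'x).
  by apply: cvg_trans (gU' _ U'x); apply: near_eq_cvg.
rewrite is_CkS; split=> [x /fU[g [U' [oU' U'x [dg _] gf]]]|v].
  apply: (@near_eq_differentiable _ _ _ g); last exact: dg.
  by have := open_nbhs_nbhs (conj oU' U'x); apply: filterS.
apply: IH => x /fU[g [U' [oU' U'x [_ Dg] gf]]].
exists ('D_v g), U'; split=> //; first exact: Dg.
move=> y U'y.
apply: near_eq_derive.
by have := open_nbhs_nbhs (conj oU' U'y); apply: filterS.
Qed.

(** On an open set, equal values mean equal germs. Derivative formulas valid only on [U] enter the
    later inductions this way. *)
Lemma eq_is_Ck V W k (U : set V) (g f : V -> W) : open U ->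
  (forall x, U x -> g x = f x) -> is_Ck k U g -> is_Ck k U f.
Proof. by move=> oU gf gU; apply: is_Ck_local => x Ux; exists g, U. Qed.

Lemma is_Ck_cst V W k (U : set V) (a : W) : is_Ck k U (cst a : V -> W).
Proof.
elim: k a => [|k IH] a; first by move=> x _; exact: cvg_cst.
rewrite is_CkS; split=> [x _|v]; first exact: differentiable_cst.
by under [X in is_Ck _ _ X]funext do rewrite derive_cst; exact: IH.
Qed.

Lemma is_CkD V W k (U : set V) (f g : V -> W) : open U ->
  is_Ck k U f -> is_Ck k U g -> is_Ck k U (f + g).
Proof.
move=> oU; elim: k f g => [|k IH] f g.
  by move=> fU gU x Ux; apply: continuousD; [exact: fU|exact: gU].
rewrite !is_CkS => -[df Df] [dg Dg]; split=> [x Ux|v].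
  by apply: differentiableD; [exact: df|exact: dg].
apply: (@eq_is_Ck _ _ _ _ ('D_v f + 'D_v g)) => //; last exact: IH.
move=> x Ux; rewrite deriveD//; apply: diff_derivable; [exact: df|exact: dg].
Qed.

Lemma is_Ck_sum V W k (U : set V) m (F : 'I_m -> V -> W) : open U ->
  (forall i, is_Ck k U (F i)) -> is_Ck k U (\sum_i F i).
Proof.
move=> oU FU; elim/big_ind : _ => [|f g|i _]; last exact: FU.
  exact: is_Ck_cst.
exact: is_CkD.
Qed.

Lemma is_diff_scale V W (a da : V -> R^o) (f df : V -> W) x :
  is_diff x a da -> is_diff x f df ->
  is_diff x (fun y => a y *: f y) (fun v => a x *: df v + da v *: f x).
Proof.
move=> dax dfx.
(* Scalar multiplication is packaged as a continuous bilinear map, so the product rule becomes the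
   chain rule for [s] after the pair of [a] and [f]. *)
pose scale (c : R^o) (w : W) : W := c *: w.
have bil : bilinear_for (GRing.Scale.Law.clone _ _ *:%R _)
    (GRing.Scale.Law.clone _ _ *:%R _) scale.
  split=> [w|c] b y z /=; first by rewrite /scale scalerDl scalerA.
  by rewrite /scale scalerDr !scalerA mulrC.
pose sB := bilinear_isBilinear.Build _ _ _ _ _ _ scale bil.
pose s : {bilinear R^o -> W -> W} := HB.pack scale sB.
have sc : continuous (fun p => s p.1 p.2).
  by move=> p; apply: cvgZ; [exact: cvg_fst|exact: cvg_snd].
have ds p : is_diff p (fun q => s q.1 q.2) (fun q => s p.1 q.2 + s q.1 p.2).
  by apply: DiffDef; [exact: differentiable_bilin|exact: diff_bilin].
exact: (is_diff_comp (is_diff_pair dax dfx) (ds _)).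
Qed.

Lemma is_Ck_scale V W k (U : set V) (a : V -> R^o) (f : V -> W) : open U ->
  is_Ck k U a -> is_Ck k U f -> is_Ck k U (fun x => a x *: f x).
Proof.
move=> oU; elim: k a f => [|k IH] a f.
  by move=> aU fU x Ux; apply: continuousZ; [exact: aU|exact: fU].
(* Each term of the product rule keeps one factor undifferentiated, so the order-[k] regularity of
   [a] and [f] themselves is recorded too. *)
move=> aU fU; have aU' := is_Ck_pred aU; have fU' := is_Ck_pred fU.
move: aU fU; rewrite !is_CkS => -[da Da] [df Df].
have dZ x : U x -> is_diff x (fun y => a y *: f y)
    (fun v => a x *: 'd f x v + 'd a x v *: f x).
  by move=> Ux; apply: is_diff_scale; apply: differentiableP; auto.
split=> [x Ux|v]; first by have [] := dZ _ Ux.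
apply: (@eq_is_Ck _ _ _ _
    ((fun x => a x *: 'D_v f x) + (fun x => 'D_v a x *: f x))) => //.
  move=> x Ux; have [dx dE] := dZ _ Ux.
  by rewrite deriveE// dE !fctE !deriveE//; auto.
by apply: is_CkD => //; apply: IH.
Qed.

Lemma is_diff_coord V m (f df : V -> 'rV[R]_m) i x : is_diff x f df ->
  is_diff x (fun y => f y 0 i : R^o) (fun v => df v 0 i).
Proof.
move=> dfx.
pose coord (u : 'rV[R]_m) : R^o := u 0 i.
have lin : linear coord by move=> a u v; rewrite /coord !mxE.
pose cM := GRing.isLinear.Build _ _ _ _ _ lin.
pose c : {linear 'rV[R]_m -> R^o} := HB.pack coord cM.
have cc : continuous c by exact: coord_continuous.
have dc u : is_diff u c c.
  by apply: DiffDef; [exact: linear_differentiable|exact: diff_lin].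
exact: (is_diff_comp dfx (dc _)).
Qed.

Lemma is_Ck_coord V m k (U : set V) (f : V -> 'rV[R]_m) i : open U ->
  is_Ck k U f -> is_Ck k U (fun x => f x 0 i : R^o).
Proof.
move=> oU; elim: k f => [|k IH] f.
  move=> fU x Ux.
  apply: (@continuous_comp _ _ _ f (fun u : 'rV_m => u 0 i : R^o)).
    exact: fU.
  exact: coord_continuous.
rewrite !is_CkS => -[df Df]; split=> [x Ux|v].
  by have [] := is_diff_coord i (differentiableP (df _ Ux)).
apply: (@eq_is_Ck _ _ _ _ (fun x => 'D_v f x 0 i : R^o)) => //; last exact: IH.
move=> x Ux; have [dx dE] := is_diff_coord i (differentiableP (df _ Ux)).
by rewrite [RHS]deriveE// dE deriveE//; exact: df.
Qed.

(** The direction ['D_v f x] in which [g] is differentiated moves with [x], whereas [is_Ck] controls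
    derivatives in fixed directions only. Expanding it in the standard basis leaves the fixed
    directions [delta_mx 0 i]. *)
Lemma derive_comp V m Z (f : V -> 'rV[R]_m) (g : 'rV[R]_m -> Z) v x :
  differentiable f x -> differentiable g (f x) ->
  'D_v (g \o f) x = \sum_i ('D_v f x) 0 i *: 'D_(delta_mx 0 i) g (f x).
Proof.
move=> df dg; rewrite deriveE; last exact: differentiable_comp.
rewrite diff_comp//= -(deriveE v df).
rewrite [in LHS](row_sum_delta ('D_v f x)) linear_sum.
by apply: eq_bigr => i _; rewrite linearZ -deriveE.
Qed.

Lemma is_Ck_comp V m Z k (U : set V) (U' : set 'rV[R]_m)
    (f : V -> 'rV[R]_m) (g : 'rV[R]_m -> Z) : open U ->
  (forall x, U x -> U' (f x)) ->
  is_Ck k U f -> is_Ck k U' g -> is_Ck k U (g \o f).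
Proof.
move=> oU UU'; elim: k f g UU' => [|k IH] f g UU'.
  by move=> fU gU x Ux; apply: continuous_comp; [exact: fU|exact/gU/UU'].
move=> fU gU; have fU' := is_Ck_pred fU; have gU' := is_Ck_pred gU.
move: fU gU; rewrite !is_CkS => -[df Df] [dg Dg].
split=> [x Ux|v].
  by apply: differentiable_comp; [exact: df|exact/dg/UU'].
apply: (@eq_is_Ck _ _ _ _
    (\sum_i (fun x => 'D_v f x 0 i *: ('D_(delta_mx 0 i) g \o f) x))) => //.
  move=> x Ux; rewrite fct_sumE [RHS]derive_comp//; [exact: df|exact/dg/UU'].
apply: is_Ck_sum => // i; apply: is_Ck_scale => //; last exact: IH.
exact: is_Ck_coord.
Qed.

(* [phi0] is the linear part of the affine map [phi]. *)
Lemma is_Ck_affine V W Z k (U : set W) (phi phi0 : V -> W)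
    (g : W -> Z) :
  (forall x, differentiable phi x) ->
  (forall (h : R) v x, phi (h *: v + x) = h *: phi0 v + phi x) ->
  is_Ck k U g -> is_Ck k (phi @^-1` U) (g \o phi).
Proof.
move=> dphi phiE; elim: k g => [|k IH] g.
  move=> gU x Ux; apply: (@continuous_comp _ _ _ phi g); last exact: gU.
  exact: differentiable_continuous.
rewrite !is_CkS => -[dg Dg]; split=> [x Ux|v].
  by apply: differentiable_comp => //; exact: dg.
suff -> : 'D_v (g \o phi) = 'D_(phi0 v) g \o phi by exact/IH/Dg.
have shiftE x (h : R) : (g \o phi \o shift x) (h *: v) =
    (g \o shift (phi x)) (h *: phi0 v) by rewrite /= phiE.
apply/funext => x; rewrite /derive.
by under [X in lim (X @ _)]funext do rewrite shiftE.
Qed.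

End Ck.

(** * Smooth maps between manifolds, in charts *)

Section SmoothMaps.
Context {R : realType}.

Lemma open_chart_image (E : normedModType R) (M : topologicalType)
    (c : chart M E) (P : set M) :
  is_chart c -> open P -> open (cmap c @` (cdom c `&` P)).
Proof.
move=> [oD oI cK _ cinv_cont] oP; rewrite openE => _ [x [cx Px] <-].
have Iy : (cmap c @` cdom c) (cmap c x) by exists x.
have : nbhs (cmap c x) (cinv c @^-1` P).
  by apply: cinv_cont => //; rewrite cK//; exact: open_nbhs_nbhs.
have := open_nbhs_nbhs (conj oI Iy); apply: filterS2 => _ [z cz <-].
by rewrite /= cK// => Pz; exists z.
Qed.

(** One chart of [N] need not contain the whole image of [f], so a chart [d] is chosen around each
    [f x] and the coordinate expression is factored through it locally. The middle model space
    consists of row vectors, as [is_Ck_comp] requires. *)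
Lemma smooth_map_comp (E F : normedModType R) (m : nat)
    (M N P : topologicalType) (A : set (chart M E)) (B : set (chart N 'rV[R]_m))
    (C : set (chart P F)) (f : M -> N) (g : N -> P) :
  (forall c, A c -> is_chart c) -> is_smooth_atlas B ->
  (forall c, C c -> is_chart c) ->
  smooth_map A B f -> smooth_map B C g -> smooth_map A C (g \o f).
Proof.
move=> chA [chB covB _] chC [f_cont fS] [g_cont gS].
split=> [x|c e Ac Ce k].
  by apply: continuous_comp; [exact: f_cont|exact: g_cont].
apply: is_Ck_local => _ [x [cx egfx] <-].
have [d Bd dfx] := covB (f x).
have [_ _ cK _ _] := chA _ Ac; have [oDd _ dK _ _] := chB _ Bd.
have [oDe _ _ _ _] := chC _ Ce.
(* On [Q] the point [f z] lies in [cdom d], so [cinv d] cancels [cmap d], and [g (f z)] lies in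
   [cdom e]. *)
pose Q := f @^-1` (cdom d `&` g @^-1` cdom e).
have oQ : open Q.
  by apply: open_comp => //; apply: openI => //; apply: open_comp.
exists ((cmap e \o g \o cinv d) \o (cmap d \o f \o cinv c)).
exists (cmap c @` (cdom c `&` Q)); split.
- by apply: open_chart_image => //; exact: chA.
- by exists x.
- apply: is_Ck_comp (gS _ _ Bd Ce k).
  + by apply: open_chart_image => //; exact: chA.
  + by move=> _ [z [cz Qz] <-] /=; rewrite cK//; exists (f z).
  + apply: is_Ck_subset (fS _ _ Ac Bd k) => _ [z [cz [dfz _]] <-].
    by exists z.
- by move=> _ [z [cz [dfz _]] <-] /=; rewrite cK// dK.
Qed.

(** In a chart [c] around [a], the slice inclusion reads [y |-> (cmap c a, y)], an affine map with
    linear part [v |-> (0, v)]. It takes values in a product of normed spaces, hence the use of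
    [is_Ck_affine] rather than [is_Ck_comp]. *)
Lemma smooth_map_pairl (E F Z : normedModType R) (M N P : topologicalType)
    (A : set (chart M E)) (B : set (chart N F)) (C : set (chart P Z))
    (f : M * N -> P) (a : M) :
  is_smooth_atlas A -> smooth_map (prod_atlas A B) C f ->
  smooth_map B C (fun y => f (a, y)).
Proof.
move=> [chA covA _] [f_cont fS]; split=> [y|d e Bd Ce k].
  apply: (@continuous_comp _ _ _ (fun y => (a, y)) f); last exact: f_cont.
  by apply: cvg_pair; [exact: cvg_cst|exact: cvg_id].
have [c Ac ca] := covA a; have [_ _ cK _ _] := chA _ Ac.
have Acd : prod_atlas A B (prod_chart c d) by exists c => //; exists d.
have -> : cmap e \o (fun y => f (a, y)) \o cinv d =
    (cmap e \o f \o cinv (prod_chart c d)) \o (fun y => (cmap c a, y)).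
  by apply/funext => y /=; rewrite cK.
have := fS _ _ Acd Ce k => /(@is_Ck_affine _ _ _ _ _ _ _ (fun v => (0, v))) fk.
apply: is_Ck_subset (fk (fun y => (cmap c a, y)) _ _).
- by move=> _ [y [dy efy] <-] /=; exists (a, y).
- move=> y; apply: differentiable_pair.
  + exact: differentiable_cst.
  + exact: ex_diff.
- move=> h v y; congr pair => //=.
  by rewrite scaler0 add0r.
Qed.

Lemma smooth_map_pairr (E F Z : normedModType R) (M N P : topologicalType)
    (A : set (chart M E)) (B : set (chart N F)) (C : set (chart P Z))
    (f : M * N -> P) (b : N) :
  is_smooth_atlas B -> smooth_map (prod_atlas A B) C f ->
  smooth_map A C (fun x => f (x, b)).
Proof.
move=> [chB covB _] [f_cont fS]; split=> [y|c e Ac Ce k].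
  apply: (@continuous_comp _ _ _ (fun x => (x, b)) f); last exact: f_cont.
  by apply: cvg_pair; [exact: cvg_id|exact: cvg_cst].
have [d Bd db] := covB b; have [_ _ dK _ _] := chB _ Bd.
have Acd : prod_atlas A B (prod_chart c d) by exists c => //; exists d.
have -> : cmap e \o (fun x => f (x, b)) \o cinv c =
    (cmap e \o f \o cinv (prod_chart c d)) \o (fun x => (x, cmap d b)).
  by apply/funext => x /=; rewrite dK.
have := fS _ _ Acd Ce k => /(@is_Ck_affine _ _ _ _ _ _ _ (fun v => (v, 0))) fk.
apply: is_Ck_subset (fk (fun x => (x, cmap d b)) _ _).
- by move=> _ [x [cx efx] <-] /=; exists (x, b).
- move=> x; apply: differentiable_pair.
  + exact: ex_diff.
  + exact: differentiable_cst.
- move=> h v x; congr pair => //=.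
  by rewrite scaler0 add0r.
Qed.

Lemma real_atlas_chart (c : chart R R^o) : @real_atlas R c -> is_chart c.
Proof.
move=> ->; split=> //=; rewrite ?image_id; first exact: openT.
- exact: openT.
- by move=> x _; exact: cvg_id.
- by move=> x _; exact: cvg_id.
Qed.

End SmoothMaps.

(** * Conjugation and the exponential map of a Lie group *)

Section LieGroup.
Context {R : realType} {n : nat} {G : lieGroupType R n}.
Implicit Types (l g : G) (X : (G -> R^o) -> (G -> R^o)).

Lemma lie_atlas_chart c : @lie_atlas R n G c -> is_chart c.
Proof. by have [ch _ _] := @lie_atlasP R n G; exact: ch. Qed.

(** Left translation by [l] and right translation by its inverse are slices of the smooth
    multiplication. *)
Lemma conj_smooth l : lie_smooth (fun x : G => l * x * l^-1)%g.
Proof.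
have atl := @lie_atlasP R n G.
have L := smooth_map_pairl l atl (@lie_mul_smooth R n G).
have Rm := smooth_map_pairr l^-1%g atl (@lie_mul_smooth R n G).
exact: (smooth_map_comp lie_atlas_chart atl lie_atlas_chart L Rm).
Qed.

Lemma is_exp_Ad l X g : is_exp X g -> is_exp (Ad l X) (l * g * l^-1)%g.
Proof.
move=> [gamma [[gammaD gammaS] dgamma <-]].
have atl := @lie_atlasP R n G.
exists (fun t => l * gamma t * l^-1)%g; split=> //; first split.
- by move=> s t; rewrite gammaD !mulgA mulgVK.
- exact: (smooth_map_comp (@real_atlas_chart R) atl lie_atlas_chart gammaS
    (conj_smooth l)).
- move=> f fS.
  (* Testing the conjugated curve against [f] is testing [gamma] against [f] composed with
     conjugation by [l]. The factor [1] removed below is the base point in [differential]. *)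
  have := smooth_map_comp lie_atlas_chart atl (@real_atlas_chart R)
    (conj_smooth l) fS.
  move/dgamma; rewrite /Ad /differential.
  suff -> : (fun x => f (1 * (l * x * l^-1))%g) =
    f \o (fun x => l * x * l^-1)%g by [].
  by apply/funext => x; rewrite mul1g.
Qed.

(* [is_exp] only uses the tangent vector of [X] at 1. *)
Lemma is_exp_AdV l X g : is_exp (Ad l X) g -> is_exp X (l^-1 * g * l)%g.
Proof.
move=> /(is_exp_Ad l^-1%g); rewrite invgK => -[gamma [gammaP dgamma gamma1]].
exists gamma; split=> // f /dgamma; rewrite /Ad /differential.
suff -> : (fun x => f (1 * (l^-1 * (1 * (l * x * l^-1)) * l^-1^-1))%g) = f.
  by [].
by apply/funext => x; rewrite !mul1g invgK !mulgA mulVg mul1g mulgVK.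
Qed.

Lemma exp_image_Ad l (V : set ((G -> R^o) -> (G -> R^o))) :
  exp_image (Ad l @` V) = (fun x : G => l * x * l^-1)%g @` exp_image V.
Proof.
apply/seteqP; split=> [g [_ [X VX <-] expg]|_ [g [X VX expg] <-]].
  exists (l^-1 * g * l)%g; last by rewrite !mulgA mulgV mul1g mulgK.
  by exists X => //; exact: is_exp_AdV.
by exists (Ad l X); [exists X|exact: is_exp_Ad].
Qed.

Lemma subgroup_fixed_points (nu : G -> G) :
  {morph nu : x y / (x * y)%g} -> subgroup (fixed_points nu).
Proof.
move=> nuM; have nu1 : nu 1%g = 1%g.
  by apply: (@mulgI _ (nu 1%g)); rewrite -nuM !mulg1.
split=> [//|x y nux nuy|x nux]; rewrite /fixed_points /=.
  by rewrite nuM nux nuy.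
by apply: (@mulgI _ x); rewrite -{1}nux -nuM !mulgV.
Qed.

End LieGroup.

(** * Conjugating normalizers and centralizers *)

Local Notation conj l := (fun x => l * x * l^-1)%g.

Section Conjugation.
Context {G : groupType}.
Implicit Types (l x : G) (g : G * G) (C : set G).

Lemma conjK l : cancel (conj l) (conj l^-1)%g.
Proof. by move=> x; rewrite invgK !mulgA mulVg mul1g mulgVK. Qed.

Lemma conj_imageK l C : conj l^-1%g @` (conj l @` C) = C.
Proof.
rewrite image_comp -[RHS]image_id; congr (_ @` _).
by apply/funext => x; exact: conjK.
Qed.

Lemma diag_conjK l : cancel (diag_conj l) (diag_conj l^-1%g).
Proof. by case=> x y; rewrite /diag_conj /= !conjK. Qed.

Lemma two_sided_act_diag_conj l g x :
  two_sided_act (diag_conj l g) (conj l x) = conj l (two_sided_act g x).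
Proof. by rewrite /two_sided_act /= !invgM invgK !mulgA !mulgVK. Qed.

End Conjugation.

Section SubgroupConjugation.
Context {R : realType} {n : nat} {G : lieGroupType R n}.
Implicit Types (l : G) (g : G * G) (C : set G).
Variables (K H : set G).
Hypotheses (subK : subgroup K) (subH : subgroup H).

(** The first component stays in [K] because [l] is in [K], the second stays in [H] because [l] is
    in [H]. *)
Lemma subgroup_diag_conj l g : K l -> H l -> (K `*` H) g ->
  (K `*` H) (diag_conj l g).
Proof.
have [_ KM KV] := subK; have [_ HM HV] := subH.
by move=> Kl Hl [Kg Hg]; split;
  [apply/KM/KV => //; exact: KM|apply/HM/HV => //; exact: HM].
Qed.

Lemma normalizer_in_conj l C : K l -> H l ->
  normalizer_in K H (conj l @` C) = diag_conj l @` normalizer_in K H C.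
Proof.
have sub m D : K m -> H m ->
    diag_conj m @` normalizer_in K H D `<=` normalizer_in K H (conj m @` D).
  move=> Km Hm _ [g [KHg gD] <-]; split; first exact: subgroup_diag_conj.
  (* Writing [D] as its own image under [g] on one side only makes both sides images of [D], under
     two maps equal by equivariance. *)
  rewrite -[in RHS]gD !image_comp; congr (_ @` _).
  by apply/funext => x; exact: two_sided_act_diag_conj.
move=> Kl Hl; apply/seteqP; split; last exact: sub.
have [_ _ KV] := subK; have [_ _ HV] := subH.
move=> g Ng; exists (diag_conj l^-1%g g); last first.
  by rewrite -{1}(invgK l) diag_conjK.
by rewrite -(conj_imageK l C); apply: sub; [exact: KV|exact: HV|exists g].
Qed.

Lemma centralizer_in_conj l C : K l -> H l ->
  centralizer_in K H (conj l @` C) = diag_conj l @` centralizer_in K H C.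
Proof.
(* As for normalizers, with equivariance applied pointwise: [g] fixes [x] in [D], so its conjugate
   fixes [conj m x]. *)
have sub m D : K m -> H m ->
    diag_conj m @` centralizer_in K H D `<=` centralizer_in K H (conj m @` D).
  move=> Km Hm _ [g [KHg gD] <-]; split; first exact: subgroup_diag_conj.
  by move=> _ [x Dx <-]; rewrite two_sided_act_diag_conj gD.
move=> Kl Hl; apply/seteqP; split; last exact: sub.
have [_ _ KV] := subK; have [_ _ HV] := subH.
move=> g Ng; exists (diag_conj l^-1%g g); last first.
  by rewrite -{1}(invgK l) diag_conjK.
by rewrite -(conj_imageK l C); apply: sub; [exact: KV|exact: HV|exists g].
Qed.

End SubgroupConjugation.

Theorem proposition3p1 (R : realType) (n : nat) (G : lieGroupType R n)
  (G_connected : connected [set: G]) (G_noncompact : ~ compact [set: G])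
  (G_semisimple : @semisimple R n G)
  (sigma : G -> G) (sigma_inv : involutive_automorphism sigma)
  (H : set G) (H_subgroup : subgroup H) (H_closed : closed H)
  (H_lower : identity_component (fixed_points sigma) `<=` H)
  (H_upper : H `<=` fixed_points sigma)
  (theta : G -> G) (theta_cartan : cartan_involution theta)
  (theta_sigma : theta \o sigma = sigma \o theta)
  (a0 b0 : set ((G -> R^o) -> (G -> R^o)))
  (a0_max : maximal_abelian_subspace_of
              (minus_eigenspace theta `&` minus_eigenspace sigma) a0)
  (b0_max : maximal_abelian_subspace_of
              (minus_eigenspace theta `&` minus_eigenspace sigma) b0)
  (l : G) (l_KH : (fixed_points theta `&` H) l)
  (b0_def : b0 = Ad l @` a0) :
  let K := fixed_points theta in
  let A := exp_image a0 in
  let B := exp_image b0 in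
  normalizer_in K H B = diag_conj l @` normalizer_in K H A /\
  centralizer_in K H B = diag_conj l @` centralizer_in K H A.
Proof.
move=> K A B.
have [[thetaM _ _] _] := theta_cartan.1.
have subK := subgroup_fixed_points thetaM.
have [Kl Hl] := l_KH.
rewrite /B b0_def exp_image_Ad.
by split; [exact: normalizer_in_conj|exact: centralizer_in_conj].
Qed.
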